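(* Let $X$ be a Hausdorff topological space, $Y$ a Polish space, and $b:X\times Y\to\mathbb{R}\cup\{-\infty\}$ a kernel satisfying the standing assumptions of the context. Let $(F_n)_{n\in\mathbb{N}}$ be an asymptotically tight sequence in $\mathcal{QL}(C_b(Y))$ such that $\limsup_{n\to\infty}F_n(Y)<+\infty$ and $\lim_{n\to\infty}\rho(F_n)=0$. Let $g:X\to\overline{\mathbb{R}}$ be defined by $$g(x)=\limsup_{n\to\infty}F_n(b(x,\cdot))\quad\text{for all }x\in X,$$ and let $\overline{F}$ be the continuous max-plus linear form with density $B^\circ g$. Assume that all of the following hold: - either $Y$ is discrete, or ($b$ is continuous in the second variable and $B^\circ g(y)>-\infty$ for all $y\in Y$); - either $B^\circ g\in\mathcal{F}_c$, or $b$ is coercive; - $b$ is upper coercive; - $B^\circ g$ is quasi-continuous on its domain. Then: (i) There exist $F\in\mathcal{L}(C_b(Y))$ and a subsequence of $(F_n)_{n\in\mathbb{N}}$ which converges weakly towards $F$. (ii) $\{(\partial^\circ g)^{-1}(y)\}_{y\in\operatorname{ldom}(B^\circ g)}$ is a covering of $\operatorname{idom}(g)$. (iii) If $F$ is an accumulation point of $(F_n)_{n\in\mathbb{N}}$ for the weak convergence, and $f$ is the l.s.c. density of $F$, then $f\ge B^\circ g$. Hence $\limsup_{n\to\infty}F_n(C)\le\overline{F}(C)$ for all closed $C\subset Y$. Assume in addition that the limsup defining $g$ is a limit (for every $x\in X$), and let $Z=Z_a\cup\operatorname{int}(Z_t)$, where $Z_a$ (resp. $Z_t$) is the set of algebraically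 (resp. topologically) essential elements $y\in \operatorname{ldom}(B^\circ g)$ with respect to the covering of $\operatorname{idom}(g)$ by $\{(\partial^\circ g)^{-1}(y)\}_{y\in\operatorname{ldom}(B^\circ g)}$, and $\operatorname{int}(Z_t)$ is the interior of $Z_t$ relative to $\operatorname{dom}(B^\circ g)$. Then: (iv) If $F$ and $f$ are as in (iii), then $f=B^\circ g$ on $Z$. Hence $\liminf_{n\to\infty}F_n(G)\ge\overline{F}(G\cap Z)$ for all open $G\subset Y$. (v) If $\{(\partial^\circ g)^{-1}(y)\}_{y\in\operatorname{ldom}(B^\circ g)}$ is a topologically minimal covering of $\operatorname{idom}(g)$, then $F_n$ weakly converges towards $\overline{F}$.
   Context: Conventions: $\overline{\mathbb{R}}=\mathbb{R}\cup\{\pm\infty\}$, $-\infty$ is absorbing for addition (so $(-\infty)+(+\infty)=-\infty$), and $a-b$ means $a+(-b)$. $\mathbb{R}_{\max}=\mathbb{R}\cup\{-\infty\}$ (with its usual topology), $\vee$ is the (pointwise) maximum, functions are ordered pointwise, ''l.s.c.'' means lower semicontinuous. Standing assumptions on $b$: $b:X\times Y\to\mathbb{R}\cup\{-\infty\}$ is l.s.c. in the second variable; for every $x\in X$ there is $y\in Y$ with $b(x,y)\in\mathbb{R}$, and for every $y\in Y$ there is $x\in X$ with $b(x,y)\in\mathbb{R}$. Conjugacy and subdifferential: for $g:X\to\overline{\mathbb{R}}$, $B^\circ g(y)=\sup_{x\in X}\big(b(x,y)-g(x)\big)$, $y\in Y$. For $x\in X$, $\partial^\circ g(x)=\{y\in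 Y: b(x,y)\in\mathbb{R},\ b(x',y)-g(x')\le b(x,y)-g(x)\ \forall x'\in X\}$, and $(\partial^\circ g)^{-1}(y)=\{x\in X: y\in\partial^\circ g(x)\}$. Domains: for a map $h$ from a topological space $S$ to $\overline{\mathbb{R}}$, $\operatorname{ldom}(h)=\{s:h(s)<+\infty\}$, $\operatorname{dom}(h)=\{s:h(s)\in\mathbb{R}\}$, $\operatorname{idom}(h)=\{s\in\operatorname{dom}(h):\limsup_{s'\to s}h(s')<+\infty\}$. $h$ is quasi-continuous if for every open $G\subset\overline{\mathbb{R}}$, $h^{-1}(G)$ is contained in the closure of its interior; ''quasi-continuous on its domain'' means that the restriction of $h$ to $\operatorname{dom}(h)$ (with the relative topology) is quasi-continuous. Coverings: a family $\{\Phi(z)\}_{z\in Z'}$ of subsets of a set is a covering of $W'$ if $\bigcup_{z\in Z'}\Phi(z)\supset W'$. An element $y\in Z'$ is algebraically essential if $W'\not\subset\bigcup_{z\in Z'\setminus\{y\}}\Phi(z)$; when $Z'$ carries a topology, $y$ is topologically essential if $W'\not\subset\bigcup_{z\in Z'\setminus U}\Phi(z)$ for every open neighbourhood $U$ of $y$ in $Z'$. The covering is topologically minimal if all elements of $Z'$ are topologically essential. (Here $Z'=\operatorname{ldom}(B^\circ g)\subset Y$ with the relative topology.) Coercivity: for $x\in X$, $W\subset X$, put $b_{x,W}(y)=\sup_{z\in W}b(z,y)-b(x,y)$. $b$ is coercive if for all $x\in X$ and all neighbourhoods $V$ of $x$, the set $\{y\in Y:b_{x,V}(y)\le\beta\}$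 is relatively compact for all $\beta\in\mathbb{R}$. $b$ is upper coercive if for all $x\in X$ and all neighbourhoods $V$ of $x$ there is a finite $W\subset V$ such that $b(x,\cdot)$ is bounded above on each set $\{y:b_{x,W}(y)\le\beta\}$, $\beta\in\mathbb{R}$. $\mathcal{F}_c$ is the set of l.s.c. $f:Y\to\overline{\mathbb{R}}$ such that for all $x\in X$ and $\beta\in\mathbb{R}$ the set $\{y\in Y:b(x,y)-f(y)\ge\beta\}$ is relatively compact. Function spaces: $(\mathbb{R}_{\max})^Y$ is the set of functions $Y\to\mathbb{R}_{\max}$; $\mathrm{lsc}(Y)$ is the subset of l.s.c. functions; $C_b(Y)$ is the subset of continuous functions bounded above by a real constant. Quasi-linear forms: a map $F:C_b(Y)\to\overline{\mathbb{R}}$ is a quasi-(max-plus-)linear form if it is isotone, additively homogeneous ($F(\lambda+\varphi)=\lambda+F(\varphi)$ for all $\lambda\in\mathbb{R}_{\max}$), and there exists $\alpha\in\mathbb{R}_{\max}$ such that $F(\varphi\vee\psi)\le\alpha+F(\varphi)\vee F(\psi)$ for all $\varphi,\psi$; $\rho(F)$ denotes the infimum of such $\alpha$. $F$ is continuous if $F(\varphi_k)\to F(\varphi)$ whenever $\varphi_k\in C_b(Y)$ is nondecreasing in $k$ and converges pointwise to $\varphi\in C_b(Y)$. $\mathcal{QL}(C_b(Y))$ is the set of continuous quasi-linear forms $C_b(Y)\to\mathbb{R}_{\max}$, and $\mathcal{L}(C_b(Y))=\{F\in\mathcal{QL}(C_b(Y)):\rho(F)\le0\}$ (the continuous max-plus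 linear forms with values in $\mathbb{R}_{\max}$). Each $F\in\mathcal{L}(C_b(Y))$ has a unique l.s.c. density, i.e. a unique l.s.c. $f:Y\to\overline{\mathbb{R}}$ with $F(\varphi)=\sup_{y\in Y}(\varphi(y)-f(y))$ for all $\varphi\in C_b(Y)$. Extension: $F\in\mathcal{QL}(C_b(Y))$ is extended to $\mathrm{lsc}(Y)$ by $F(\varphi)=\sup\{F(\psi):\psi\in C_b(Y),\ \psi\le\varphi\}$, then to $(\mathbb{R}_{\max})^Y$ by $F(\varphi)=\inf\{F(\psi):\psi\in\mathrm{lsc}(Y),\ \psi\ge\varphi\}$, with values in $\overline{\mathbb{R}}$. For $A\subset Y$, $F(A):=F(\mathbf{1}_A)$, where $\mathbf{1}_A(y)=0$ if $y\in A$ and $-\infty$ otherwise. The form $\overline{F}$ is $\overline{F}(\varphi)=\sup_{y\in Y}(\varphi(y)-B^\circ g(y))$, so that $\overline{F}(A)=\sup_{y\in A}(-B^\circ g(y))$. Weak convergence: $F_n$ weakly converges towards $F$ if $\lim_nF_n(\varphi)=F(\varphi)$ for all $\varphi\in C_b(Y)$; $F$ is an accumulation point of $(F_n)$ for the weak convergence if some subsequence weakly converges towards $F$. $(F_n)$ is asymptotically tight if $\limsup_n\rho(F_n)<+\infty$ and $\inf_{K\subset Y,\ K\text{ compact}}\limsup_{n\to\infty}F_n(K^c)=-\infty$, with $K^c=Y\setminus K$. *)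

(* Defs.v *)
From HB Require Import structures.
From mathcomp Require Import all_boot all_order all_algebra.
From mathcomp Require Import all_classical all_reals all_analysis.

Set Implicit Arguments.
Unset Strict Implicit.
Unset Printing Implicit Defensive.

Import Order.TTheory GRing.Theory Num.Theory.
Import numFieldNormedType.Exports.

Local Open Scope classical_set_scope.
Local Open Scope ring_scope.
Local Open Scope ereal_scope.

(* The addition of \bar R in MathComp-Analysis has -oo absorbing
   ((-oo) + (+oo) = -oo) and a - b is a + (- b).
   R_max-valued functions are functions to \bar R that never take the value
   +oo; the order topology of \bar R induces the usual one on R_max. *)

Section Topology.
Context {R : realType}.

Definition is_metric (T : Type) (d : T -> T -> R) : Prop :=
  [/\ forall x y, (0 <= d x y)%R,
      forall x y, d x y = 0%R <-> x = y,
      forall x y, d x y = d y x &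
      forall x y z, (d x z <= d x y + d y z)%R].

Definition metrizes (T : topologicalType) (d : T -> T -> R) : Prop :=
  forall (x : T) (A : set T), nbhs x A <->
    exists2 e : R, (0 < e)%R & [set y | (d x y < e)%R] `<=` A.

Definition metric_complete (T : topologicalType) (d : T -> T -> R) : Prop :=
  forall u : nat -> T,
    (forall e : R, (0 < e)%R -> exists N, forall m n,
       (N <= m)%N -> (N <= n)%N -> (d (u m) (u n) < e)%R) ->
    exists l : T, u n @[n --> \oo] --> l.

Definition polish_space (T : topologicalType) : Prop :=
  (exists2 D : set T, countable D & dense D) /\
  (exists d : T -> T -> R, [/\ is_metric d, metrizes d & metric_complete d]).

Context {T : topologicalType}.
Implicit Type h : T -> \bar R.

Definition ldom h : set T := [set s | h s < +oo].
Definition edom h : set T := [set s | h s \is a fin_num].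
Definition idom h : set T :=
  [set s | edom h s /\ limf_esup h (nbhs s) < +oo].

Definition quasi_continuous {S : topologicalType} (h : S -> \bar R) : Prop :=
  forall G : set (\bar R), open G -> h @^-1` G `<=` closure (interior (h @^-1` G)).

(* [sigL D h] is the restriction of h to the subtype D, whose topology is the
   relative one. *)
Definition quasi_continuous_on_dom h : Prop :=
  quasi_continuous (sigL (edom h) h).

End Topology.

Definition relative_interior {T : topologicalType} (D A : set T) : set T :=
  set_val @` interior (set_val @^-1` A : set D).

Section Coverings.
Context {S W : Type}.
Variables (Z : set S) (Phi : S -> set W) (W' : set W).

Definition is_covering : Prop := W' `<=` \bigcup_(z in Z) Phi z.

Definition alg_essential : set S :=
  [set y | Z y /\ ~ (W' `<=` \bigcup_(z in Z `\ y) Phi z)].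
End Coverings.

Section TopCoverings.
Context {S : topologicalType} {W : Type}.
Variables (Z : set S) (Phi : S -> set W) (W' : set W).

(* The relatively open neighbourhoods of y in Z are the sets Z `&` U with U
   open in S and U y, and Z minus Z `&` U is Z `\` U. *)
Definition top_essential : set S :=
  [set y | Z y /\ forall U : set S, open U -> U y ->
                  ~ (W' `<=` \bigcup_(z in Z `\` U) Phi z)].

Definition top_minimal_covering : Prop :=
  is_covering Z Phi W' /\ Z `<=` top_essential.
End TopCoverings.

Section Kernel.
Context {R : realType} {X Y : topologicalType}.
Variable b : X -> Y -> \bar R.

Definition standing_assumptions : Prop :=
  [/\ forall x y, b x y < +oo,
      forall x, lower_semicontinuous (b x),
      forall x, exists y, b x y \is a fin_num &
      forall y, exists x, b x y \is a fin_num].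

Definition conjugate (g : X -> \bar R) (y : Y) : \bar R :=
  ereal_sup (range (fun x => b x y - g x)).

Definition subdiff (g : X -> \bar R) (x : X) : set Y :=
  [set y | b x y \is a fin_num /\
           forall x', b x' y - g x' <= b x y - g x].

Definition inv_subdiff (g : X -> \bar R) (y : Y) : set X :=
  [set x | subdiff g x y].

Definition relative_kernel (x : X) (W : set X) (y : Y) : \bar R :=
  ereal_sup [set b z y | z in W] - b x y.

Definition coercive : Prop :=
  forall (x : X) (V : set X), nbhs x V -> forall beta : R,
    precompact [set y | relative_kernel x V y <= beta%:E].

Definition upper_coercive : Prop :=
  forall (x : X) (V : set X), nbhs x V ->
    exists W : set X, [/\ finite_set W, W `<=` V &
      forall beta : R, exists M : R,
        forall y, relative_kernel x W y <= beta%:E -> b x y <= M%:E].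

Definition Fc : set (Y -> \bar R) :=
  [set f | lower_semicontinuous f /\
           forall (x : X) (beta : R),
             precompact [set y | beta%:E <= b x y - f y]].

End Kernel.

(* A form on Cb is represented by a total map (Y -> \bar R) -> \bar R; only its
   values on Cb are used below (in particular by the extensions). *)
Section Forms.
Context {R : realType} {Y : topologicalType}.
Implicit Types (F : (Y -> \bar R) -> \bar R) (f phi psi : Y -> \bar R).

Definition Cb : set (Y -> \bar R) :=
  [set phi | continuous phi /\ exists M : R, forall y, phi y <= M%:E].

Definition lsc : set (Y -> \bar R) :=
  [set phi | (forall y, phi y < +oo) /\ lower_semicontinuous phi].

Definition isotone F : Prop :=
  forall phi psi, Cb phi -> Cb psi ->
    (forall y, phi y <= psi y) -> F phi <= F psi.

Definition additively_homogeneous F : Prop :=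
  forall (lam : \bar R) phi, lam < +oo -> Cb phi ->
    F (fun y => lam + phi y) = lam + F phi.

Definition quasi_max_constants F : set (\bar R) :=
  [set alpha | alpha < +oo /\
     forall phi psi, Cb phi -> Cb psi ->
       F (fun y => maxe (phi y) (psi y)) <= alpha + maxe (F phi) (F psi)].

Definition quasi_linear_form F : Prop :=
  [/\ isotone F, additively_homogeneous F & quasi_max_constants F !=set0].

Definition rho F : \bar R := ereal_inf (quasi_max_constants F).

Definition continuous_form F : Prop :=
  forall (phis : nat -> Y -> \bar R) phi,
    (forall k, Cb (phis k)) -> Cb phi ->
    (forall k y, phis k y <= phis k.+1 y) ->
    (forall y, phis k y @[k --> \oo] --> phi y) ->
    F (phis k) @[k --> \oo] --> F phi.

Definition QL : set ((Y -> \bar R) -> \bar R) :=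
  [set F | [/\ quasi_linear_form F, continuous_form F &
               forall phi, Cb phi -> F phi < +oo]].

Definition Lin : set ((Y -> \bar R) -> \bar R) :=
  [set F | QL F /\ rho F <= 0].

Definition form_of_density f phi : \bar R :=
  ereal_sup (range (fun y => phi y - f y)).

Definition lsc_density F f : Prop :=
  lower_semicontinuous f /\
  forall phi, Cb phi -> F phi = form_of_density f phi.

Definition ext_lsc F phi : \bar R :=
  ereal_sup [set F psi | psi in [set psi | Cb psi /\
                                           forall y, psi y <= phi y]].

(* For F in QL this agrees with [ext_lsc F] on lsc functions and with F on
   Cb. *)
Definition ext F phi : \bar R :=
  ereal_inf [set ext_lsc F psi | psi in [set psi | lsc psi /\
                                                   forall y, phi y <= psi y]].

Definition max_indic (A : set Y) (y : Y) : \bar R :=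
  if y \in A then 0 else -oo.

Implicit Types Fs : nat -> (Y -> \bar R) -> \bar R.

Definition weak_cvg Fs F : Prop :=
  forall phi, Cb phi -> Fs n phi @[n --> \oo] --> F phi.

Definition weak_accumulation Fs F : Prop :=
  exists2 s : nat -> nat, {homo s : m n / (m < n)%N} &
    weak_cvg (fun k => Fs (s k)) F.

Definition asymptotically_tight Fs : Prop :=
  limn_esup (fun n => rho (Fs n)) < +oo /\
  ereal_inf [set limn_esup (fun n => ext (Fs n) (max_indic (~` K)))
            | K in [set K : set Y | compact K]] = -oo.

End Forms.

(* Main.v *)
Require Import Defs.
From HB Require Import structures.
From mathcomp Require Import all_boot all_order all_algebra.
From mathcomp Require Import all_classical all_reals all_analysis.
From mathcomp Require Import lra.

Set Implicit Arguments.
Unset Strict Implicit.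
Unset Printing Implicit Defensive.

Import Order.TTheory GRing.Theory Num.Theory.
Import numFieldNormedType.Exports.

Local Open Scope classical_set_scope.
Local Open Scope ring_scope.
Local Open Scope ereal_scope.

(** Write F(psi) also for the extension of a form to l.s.c. functions, which
    on increasing limits of functions of Cb is the limit of the values of F.
    The proof is a Galois-connection argument combined with the large deviation
    dictionary: -F_n(1_U) plays the role of a rate, and a density is a rate
    function.

    Two facts carry the topology. First, if phi is bounded above and every
    point has a neighbourhood on which phi is dominated by an l.s.c. function
    psi with limsup F_n(psi) < t, then limsup F_n(phi) < t
    ([locally_bounded_limsup]): tightness leaves a
    compact set, finitely many psi cover it, and a finite maximum costs a
    multiple of rho(F_n), which vanishes in the limit. Secondly, every sequence
    satisfying the hypotheses has a subsequence converging weakly to a form with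
    an l.s.c. density ([weak_sequential_compactness]): extract so that the masses
    of a countable base of open sets converge, and apply the first fact. This is
    (i).

    The first half of (iii) is the adjunction: any Cb minorant psi of b x
    satisfies psi - f <= F(psi) <= g x, hence b x - f <= g x, that is Bg <= f. The
    bound on closed sets follows from the local bound, the majorants of the
    indicator of C being translates of the functions b x.

    For (ii) fix x in idom g. Upper coercivity shows that the mass g x of b x is
    already carried by a truncation of b x, which is bounded above. If y is not a
    subgradient of g at x, some b x' has b x' - g x' > b x - g x at y, so that
    near y the function b x is dominated by a translate of b x' (or by a constant,
    if b x y = -oo) of limiting mass less than g x. If the subgradients could be treated in the same way, the local
    bound would give g x < g x. So some subgradient y is charged
    ([exists_charged_subgradient]), and subgradients lie in ldom Bg.

    For (iv) let F be a limit of a subsequence, with density f. Since g is a full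
    limit, the previous statement applies to the subsequence. If the charged
    subgradient y had f y > Bg y, a bump function near y, whose limiting mass is
    bounded by means of f, would give a majorant of mass less than g x. Hence the
    set S where f = Bg is finite already covers idom g
    ([subgradient_of_equality]). An algebraically essential point must belong
    to S, and S meets every neighbourhood of a topologically essential point;
    lower semicontinuity of f and quasi-continuity of Bg extend the equality from
    a dense set to the interior of the set of topologically essential points
    ([density_eq_on_essential]). The lower bound on open sets and (v) follow, because every subsequence has a further
    subsequence converging to a form whose density is known on Z. *)

(** * Extended real sequences and subsequences *)

Section Preliminaries.
Context {R : realType}.
Implicit Types (u : nat -> \bar R) (a l : \bar R).

Lemma ereal_lt_split a l : a < l -> exists r : R, a < r%:E < l.
Proof.
case: a => [a| |]; case: l => [l| |] //.
- rewrite lte_fin => al; exists ((a + l) / 2)%R; rewrite !lte_fin.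
  by apply/andP; split; lra.
- by move=> _; exists (a + 1)%R; rewrite lte_fin ltry andbT; lra.
- by move=> _; exists (l - 1)%R; rewrite lte_fin ltNyr /=; lra.
- by move=> _; exists 0%R; rewrite ltNyr ltry.
Qed.

Lemma cvge_order (T : Type) (F : set_system T) {FF : Filter F}
    (f : T -> \bar R) l :
  (forall a : R, a%:E < l -> \forall x \near F, a%:E < f x) ->
  (forall a : R, l < a%:E -> \forall x \near F, f x < a%:E) ->
  f @ F --> l.
Proof.
move=> Hlt Hgt A; case: l Hlt Hgt => [r| |] Hlt Hgt.
- case=> e /= e0 eA; rewrite /nbhs/=.
  have Av v : (r - e)%:E < v -> v < (r + e)%:E -> A v.
    case: v => // s; rewrite !lte_fin => h1 h2.
    by apply: (eA s); rewrite /ball_/= distrC ltr_distl; apply/andP; split; lra.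
  have Hl := Hlt (r - e)%R; have Hg := Hgt (r + e)%R.
  by near=> x; apply: Av; near: x; [apply: Hl|apply: Hg]; rewrite lte_fin; lra.
- case=> M [_ MA]; have Hl := Hlt M (ltry _).
  by near=> x; apply: MA; near: x.
- case=> M [_ MA]; have Hl := Hgt M (ltNyr _).
  by near=> x; apply: MA; near: x.
Unshelve. all: by end_near. Qed.

Lemma cvge_gt_near (T : Type) (F : set_system T) {FF : Filter F}
    (f : T -> \bar R) l a :
  f @ F --> l -> a < l -> \forall x \near F, a < f x.
Proof.
move=> fl al; have : nbhs l [set y | a < y].
  by apply: open_nbhs_nbhs; split => //; exact: open_ereal_gt_ereal.
exact: fl.
Qed.

Lemma cvge_lt_near (T : Type) (F : set_system T) {FF : Filter F}
    (f : T -> \bar R) l a :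
  f @ F --> l -> l < a -> \forall x \near F, f x < a.
Proof.
move=> fl al; have : nbhs l [set y | y < a].
  by apply: open_nbhs_nbhs; split => //; exact: open_ereal_lt_ereal.
exact: fl.
Qed.

Lemma limn_esup_lt_near u a :
  limn_esup u < a -> \forall n \near \oo, u n < a.
Proof.
move=> /ereal_inf_lt[_ [V nV <-] ult].
near=> n; apply: le_lt_trans ult; apply: ereal_sup_ubound; exists n => //.
by near: n.
Unshelve. all: by end_near. Qed.

Lemma near_limn_esup_le u a :
  (\forall n \near \oo, u n <= a) -> limn_esup u <= a.
Proof.
move=> ua; apply: ereal_inf_le; exists (ereal_sup (u @` [set n | u n <= a])).
  by exists [set n | u n <= a].
by apply: ge_ereal_sup => _ [n /= una <-].
Qed.

Lemma limn_esup_le_near u v :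
  (\forall n \near \oo, u n <= v n) -> limn_esup u <= limn_esup v.
Proof.
move=> uv; rewrite leNgt; apply/negP => /ereal_lt_split[r /andP[vr ru]].
suff : limn_esup u <= r%:E by rewrite leNgt ru.
apply: near_limn_esup_le; have := limn_esup_lt_near vr.
by apply: filterS2 uv => n /le_trans uv /ltW; exact: uv.
Qed.

Lemma subseq_cvg (s : nat -> nat) : {homo s : m n / (m < n)%N} ->
  s @ \oo --> \oo.
Proof.
move=> hs; have les n : (n <= s n)%N.
  by elim: n => // n IH; apply: leq_ltn_trans IH (hs _ _ (ltnSn n)).
move=> A [N _ NA]; exists N => // n /= Nn; apply: NA => /=.
exact: leq_trans Nn (les n).
Qed.

Lemma near_subseq (s : nat -> nat) (P : nat -> Prop) :
  {homo s : m n / (m < n)%N} ->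
  (\forall n \near \oo, P n) -> \forall n \near \oo, P (s n).
Proof. by move=> /subseq_cvg hs hP; exact: (hs _ hP). Qed.

Lemma frequently_subseq (P : nat -> Prop) :
  (forall N, exists2 n, (N <= n)%N & P n) ->
  exists2 s : nat -> nat, {homo s : m n / (m < n)%N} & forall k, P (s k).
Proof.
move=> hP.
have [h hh] : {h : nat -> nat & forall N, (N <= h N)%N /\ P (h N)}.
  apply: (@choice _ _ (fun N n => (N <= n)%N /\ P n)) => N.
  by have [n ? ?] := hP N; exists n.
pose s k := iter k (fun m => h m.+1) (h 0%N).
exists s; last by case=> [|k]; rewrite /s/=; apply: (hh _).2.
by apply: homo_ltn => [? ? ? |k]; [exact: ltn_trans|have [] := hh (s k).+1].
Qed.

End Preliminaries.

(** * Lower semicontinuous functions as monotone limits of Cb functions *)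

Section SemicontinuousApproximation.
Context {R : realType} {Y : topologicalType}.
Implicit Types (phi psi f : Y -> \bar R).

Lemma lsc_near phi y a : lower_semicontinuous phi -> a < phi y ->
  \forall z \near y, a < phi z.
Proof.
move=> lphi /ereal_lt_split[r /andP[ar rphi]].
by have [V yV VP] := lphi _ _ rphi; apply: filterS yV => z /VP /(lt_trans ar).
Qed.

Lemma near_lsc phi :
  (forall y (a : R), a%:E < phi y -> \forall z \near y, a%:E < phi z) ->
  lower_semicontinuous phi.
Proof.
by move=> H y a ay; exists [set z | a%:E < phi z] => //; exact: H.
Qed.

Lemma continuous_lsc phi : continuous phi -> lower_semicontinuous phi.
Proof. by move=> cphi; apply: near_lsc => y a; apply: cvge_gt_near; apply: cphi. Qed.

Lemma Cb_lsc phi : Cb phi -> lsc phi.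
Proof.
move=> [cphi [M phiM]]; split; last exact: continuous_lsc.
by move=> y; apply: le_lt_trans (phiM y) (ltry _).
Qed.

Lemma lsc_cst (c : \bar R) : c < +oo -> lsc (fun _ : Y => c).
Proof. by move=> cy; split => // y a ac; exists setT => //; exact: filterT. Qed.

Lemma Cb_cst (c : \bar R) : c < +oo -> Cb (fun _ : Y => c).
Proof.
move=> cy; split; first exact: cst_continuous.
by case: c cy => [r| |] // _; [exists r|exists 0%R => y; rewrite leNye].
Qed.

Lemma lsc_max phi psi : lsc phi -> lsc psi -> lsc (fun y => maxe (phi y) (psi y)).
Proof.
move=> [phiy lphi] [psiy lpsi]; split; first by move=> y; rewrite gt_max phiy psiy.
apply: near_lsc => y a; rewrite lt_max => /orP[/(lsc_near lphi)|/(lsc_near lpsi)];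
  by apply: filterS => z az; rewrite lt_max az ?orbT.
Qed.

Lemma lsc_translate (c : R) phi : lsc phi -> lsc (fun y => c%:E + phi y).
Proof.
move=> [phiy lphi]; split; first by move=> y; rewrite lte_add_pinfty ?ltry ?phiy.
apply: near_lsc => y a; rewrite -lteBlDl // => /(lsc_near lphi).
by apply: filterS => z; rewrite lteBlDl.
Qed.

Lemma lsc_max_indic (U : set Y) : open U -> lsc (max_indic U : Y -> \bar R).
Proof.
move=> oU; split; first by move=> y; rewrite /max_indic; case: ifP.
apply: near_lsc => y a; rewrite {1}/max_indic; case: ifPn => // /set_mem Uy a0.
have : nbhs y U by exact: open_nbhs_nbhs.
by apply: filterS => z Uz; rewrite /max_indic mem_set.
Qed.

Lemma Cb_max phi psi : Cb phi -> Cb psi -> Cb (fun y => maxe (phi y) (psi y)).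
Proof.
move=> [cphi [M phiM]] [cpsi [N psiN]]; split.
  move=> y; apply: cvge_order => a.
    rewrite lt_max => /orP[/(cvge_gt_near (cphi y))|/(cvge_gt_near (cpsi y))];
    by apply: filterS => z az; rewrite lt_max az ?orbT.
  rewrite gt_max => /andP[/(cvge_lt_near (cphi y)) h1 /(cvge_lt_near (cpsi y))].
  by apply: filterS2 h1 => z h1 h2; rewrite gt_max h1.
exists (Num.max M N) => y; rewrite EFin_max ge_max !le_max phiM psiN //.
by rewrite orbT.
Qed.

Lemma continuous_mine phi psi : continuous phi -> continuous psi ->
  continuous (fun y => mine (phi y) (psi y)).
Proof.
move=> cphi cpsi y; apply: cvge_order => a.
  rewrite lt_min => /andP[/(cvge_gt_near (cphi y)) h1 /(cvge_gt_near (cpsi y))].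
  by apply: filterS2 h1 => z h1 h2; rewrite lt_min h1.
rewrite gt_min => /orP[/(cvge_lt_near (cphi y))|/(cvge_lt_near (cpsi y))];
by apply: filterS => z az; rewrite gt_min az ?orbT.
Qed.

Lemma Cb_min phi psi : continuous phi -> Cb psi ->
  Cb (fun y => mine (phi y) (psi y)).
Proof.
move=> cphi [cpsi [N psiN]]; split; first exact: continuous_mine.
by exists N => y; rewrite ge_min psiN orbT.
Qed.

Lemma Cb_translate (c : R) phi : Cb phi -> Cb (fun y => c%:E + phi y).
Proof.
move=> [cphi [M phiM]]; split; last first.
  by exists (c + M)%R => y; rewrite EFinD leeD2l.
move=> y; apply: cvge_order => a.
  rewrite -lteBlDl // => /(cvge_gt_near (cphi y)).
  by apply: filterS => z; rewrite lteBlDl.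
rewrite -lteBrDl // => /(cvge_lt_near (cphi y)).
by apply: filterS => z; rewrite lteBrDl.
Qed.

(** [expand] is constant outside [-1, 1], where it is not strictly monotone;
    comparisons with real numbers are nevertheless exact on the whole line. *)
Lemma lt_expand_contract (a r : R) : (a%:E < expand r) = (contract a%:E < r)%R.
Proof.
rewrite !ltNge; congr (~~ _); apply/idP/idP => [|h]; last first.
  by rewrite -[a%:E]contractK; exact: le_expand.
move=> ra; rewrite leNgt; apply/negP => h; move: ra; apply/negP; rewrite -ltNge.
have [r1|r1] := leP 1%R r; first by rewrite expand1 // ltry.
rewrite -[a%:E]contractK lt_expand // inE ?contract_le1 //.
rewrite ler_norml (ltW r1) andbT; apply: ltW; apply: le_lt_trans h.
by have := contract_le1 a%:E; rewrite ler_norml => /andP[].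
Qed.

Lemma gt_expand_contract (a r : R) : (expand r < a%:E) = (r < contract a%:E)%R.
Proof.
have := lt_expand_contract (- a)%R (- r)%R.
by rewrite expandN -[(- a)%:E]/(- a%:E) contractN lteN2 ltrN2.
Qed.

Context (d : Y -> Y -> R) (d_metric : is_metric d) (d_top : metrizes d).

(** Inf-convolution with k d turns a lower semicontinuous function into a
    k-Lipschitz one; it is performed after compressing \bar R into [-1, 1],
    where -oo is an ordinary value. *)
Definition lipschitz_minorant phi (k : nat) (y : Y) : R :=
  inf (range (fun z => contract (phi z) + k%:R * d y z)%R).

Let d_ge0 x y : (0 <= d x y)%R. Proof. by case: d_metric. Qed.
Let d_xx x : d x x = 0%R. Proof. by case: d_metric => _ /(_ x x)[_ ->]. Qed.

Lemma lipschitz_minorant_lb phi k y :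
  has_lbound (range (fun z => contract (phi z) + k%:R * d y z)%R).
Proof.
exists (-1)%R => _ [z _ <-]; have := contract_le1 (phi z).
rewrite ler_norml => /andP[h _].
by have := mulr_ge0 (ler0n R k) (d_ge0 y z); lra.
Qed.

Lemma lipschitz_minorant_le_at phi k y z :
  (lipschitz_minorant phi k y <= contract (phi z) + k%:R * d y z)%R.
Proof. by apply: ge_inf; [exact: lipschitz_minorant_lb|exists z]. Qed.

Lemma le_lipschitz_minorant phi k y (a : R) :
  (forall z, a <= contract (phi z) + k%:R * d y z)%R ->
  (a <= lipschitz_minorant phi k y)%R.
Proof.
move=> H; apply: lb_le_inf; last by move=> _ [z _ <-].
by exists (contract (phi y) + k%:R * d y y)%R; exists y.
Qed.

Lemma lipschitz_minorant_le phi k y :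
  (lipschitz_minorant phi k y <= contract (phi y))%R.
Proof. by have := lipschitz_minorant_le_at phi k y y; rewrite d_xx mulr0 addr0. Qed.

Lemma lipschitz_minorant_lipschitz phi k y z :
  (lipschitz_minorant phi k y <= lipschitz_minorant phi k z + k%:R * d y z)%R.
Proof.
rewrite -lerBlDr; apply: le_lipschitz_minorant => t.
have := lipschitz_minorant_le_at phi k y t.
have : (d y t <= d y z + d z t)%R by case: d_metric.
by move/(ler_wpM2l (ler0n R k)); lra.
Qed.

Lemma near_dist y (e : R) : (0 < e)%R -> \forall z \near y, (d y z < e)%R.
Proof. by move=> e0; apply/d_top; exists e. Qed.

Lemma lipschitz_minorant_continuous phi k y (e : R) : (0 < e)%R ->
  \forall z \near y, (`|lipschitz_minorant phi k y - lipschitz_minorant phi k z| < e)%R.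
Proof.
move=> e0; have e1 : (0 < e / k.+1%:R)%R by rewrite divr_gt0.
apply: filterS (near_dist y e1) => z yz.
have h1 := lipschitz_minorant_lipschitz phi k y z.
have h2 := lipschitz_minorant_lipschitz phi k z y.
have dC : d z y = d y z by case: d_metric.
move: yz; rewrite ltr_pdivlMr // -natr1 => yz; rewrite dC in h2.
by have := d_ge0 y z; rewrite ltr_distl => d0; apply/andP; split; lra.
Qed.

(** The cut at level k keeps the minorant bounded above, as Cb requires. *)
Definition Cb_minorant phi (k : nat) (y : Y) : \bar R :=
  mine (expand (lipschitz_minorant phi k y)) k%:R%:E.

Lemma Cb_Cb_minorant phi k : Cb (Cb_minorant phi k).
Proof.
apply: Cb_min; last by apply: Cb_cst; rewrite ltry.
move=> y; apply: cvge_order => a; rewrite ?lt_expand_contract ?gt_expand_contract => h.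
  have e0 : (0 < lipschitz_minorant phi k y - contract a%:E)%R by lra.
  apply: filterS (lipschitz_minorant_continuous phi k y e0) => z.
  by rewrite lt_expand_contract ltr_distl => /andP[]; lra.
have e0 : (0 < contract a%:E - lipschitz_minorant phi k y)%R by lra.
apply: filterS (lipschitz_minorant_continuous phi k y e0) => z.
by rewrite gt_expand_contract ltr_distl => /andP[]; lra.
Qed.

Lemma Cb_minorant_nondecreasing phi k y :
  Cb_minorant phi k y <= Cb_minorant phi k.+1 y.
Proof.
rewrite le_min !ge_min lee_fin ler_nat leqnSn orbT andbT; apply/orP; left.
apply: le_expand; apply: le_lipschitz_minorant => z.
apply: le_trans (lipschitz_minorant_le_at phi k y z) _.
by rewrite lerD2l ler_wpM2r ?d_ge0 ?ler_nat.
Qed.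

Lemma Cb_minorant_le phi k y : Cb_minorant phi k y <= phi y.
Proof.
rewrite ge_min -[leRHS]contractK; apply/orP; left.
exact/le_expand/lipschitz_minorant_le.
Qed.

Lemma Cb_minorant_gt phi y (a : R) : lsc phi -> a%:E < phi y ->
  \forall k \near \oo, a%:E < Cb_minorant phi k y.
Proof.
move=> [_ lphi] /ereal_lt_split[c /andP[ac cphi]].
have := lsc_near lphi cphi => /d_top[e e0 he].
(* Points z farther than e from y pay a penalty at least k e, which for large k
   exceeds 2, the diameter of the range of [contract]. *)
near=> k; rewrite lt_min; apply/andP; split; last first.
  rewrite lte_fin; near: k; exists (Num.truncn `|a|).+1 => //= k ak.
  apply: le_lt_trans (ler_norm a) _.
  by apply: lt_le_trans (Num.Theory.truncnS_gt _) _; rewrite ler_nat.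
rewrite lt_expand_contract.
have : (contract c%:E <= lipschitz_minorant phi k y)%R.
  apply: le_lipschitz_minorant => z.
  have [yz|yz] := ltP (d y z) e.
    have h : (contract c%:E < contract (phi z))%R by rewrite lt_contract; exact: he.
    by have := mulr_ge0 (ler0n R k) (d_ge0 y z); lra.
  have : (2 <= k%:R * e)%R.
    rewrite -ler_pdivrMr //; near: k; exists (Num.truncn (2 / e)).+1 => //= k ek.
    by apply/ltW; apply: lt_le_trans (Num.Theory.truncnS_gt _) _; rewrite ler_nat.
  have := ler_wpM2l (ler0n R k) yz.
  have := contract_le1 (phi z); rewrite ler_norml => /andP[h1 h2].
  by have := contract_le1 c%:E; rewrite ler_norml => /andP[h3 h4]; lra.
by apply: lt_le_trans; rewrite lt_contract.
Unshelve. all: by end_near. Qed.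

Lemma Cb_minorant_cvg phi y : lsc phi ->
  Cb_minorant phi k y @[k --> \oo] --> phi y.
Proof.
move=> lphi; apply: cvge_order => a h; first exact: Cb_minorant_gt.
by near=> k; apply: le_lt_trans h; exact: Cb_minorant_le.
Unshelve. all: by end_near. Qed.

Lemma lsc_minorant_gt phi y a : lsc phi -> a < phi y ->
  exists psi, [/\ Cb psi, forall z, psi z <= phi z & a < psi y].
Proof.
move=> lphi /ereal_lt_split[r /andP[ar rphi]].
have [N _ /(_ N) h] := Cb_minorant_gt lphi rphi.
exists (Cb_minorant phi N); split; [exact: Cb_Cb_minorant|by move=> z; exact: Cb_minorant_le|].
by apply: lt_trans ar _; apply: h => /=.
Qed.

End SemicontinuousApproximation.

(** * Extensions of quasi-linear forms and the local upper bound *)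

Section Forms.
Context {R : realType} {Y : topologicalType}.
Implicit Types (F : (Y -> \bar R) -> \bar R) (phi psi f : Y -> \bar R).
Implicit Types Fs : nat -> (Y -> \bar R) -> \bar R.

Lemma ext_lsc_le F phi psi : (forall y, phi y <= psi y) ->
  ext_lsc F phi <= ext_lsc F psi.
Proof.
move=> h; apply: ereal_sup_le => _ [t [Ct tphi] <-]; exists t => //.
by split=> // y; apply: le_trans (h y).
Qed.

Lemma Cb_le_ext_lsc F phi psi : Cb psi -> (forall y, psi y <= phi y) ->
  F psi <= ext_lsc F phi.
Proof. by move=> Cpsi h; apply: ereal_sup_ubound; exists psi. Qed.

Lemma ext_lsc_Cb F phi : QL F -> Cb phi -> ext_lsc F phi = F phi.
Proof.
move=> [[isoF _ _] _ _] Cphi; apply/eqP; rewrite eq_le Cb_le_ext_lsc // andbT.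
by apply: ge_ereal_sup => _ [t [Ct tphi] <-]; exact: isoF.
Qed.

Lemma ext_le_ext_lsc F phi psi : lsc psi -> (forall y, phi y <= psi y) ->
  ext F phi <= ext_lsc F psi.
Proof. by move=> lpsi h; apply: ereal_inf_lbound; exists psi. Qed.

Lemma ext_lscE F phi : lsc phi -> ext F phi = ext_lsc F phi.
Proof.
move=> lphi; apply/eqP; rewrite eq_le ext_le_ext_lsc //=.
by apply: le_ereal_inf_tmp => _ [t [lt h] <-]; exact: ext_lsc_le.
Qed.

Lemma ext_lsc_translate F phi (c : R) : QL F ->
  ext_lsc F (fun y => c%:E + phi y) <= c%:E + ext_lsc F phi.
Proof.
move=> [[_ homF _] _ _]; apply: ge_ereal_sup => _ [t [Ct tphi] <-].
have Ct' : Cb (fun y => (- c)%:E + t y) by exact: Cb_translate.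
rewrite -leeBlDl // addeC.
rewrite -[(- c%:E)]/((- c)%:E) -homF ?ltry //; apply: Cb_le_ext_lsc => // y.
by rewrite EFinN addeC leeBlDl.
Qed.

Lemma QL_cst F (c : R) : QL F -> F (fun=> c%:E) = c%:E + F (fun=> 0).
Proof.
move=> [[_ homF _] _ _]; rewrite -homF ?ltry //; last exact: Cb_cst.
by congr F; apply/funext => y; rewrite adde0.
Qed.

Lemma QL_Ny F : QL F -> F (fun=> -oo) = -oo.
Proof.
move=> [[_ homF _] _ _]; have := homF -oo (fun=> 0) isT.
by rewrite !addNye; apply; exact: Cb_cst.
Qed.

Context (d : Y -> Y -> R) (d_metric : is_metric d) (d_top : metrizes d).

(** This is where continuity along nondecreasing sequences enters: it carries
    quasi-maxitivity from Cb to its monotone limits. *)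
Lemma ext_lsc_max F (e : R) phi psi : QL F ->
  (forall s t, Cb s -> Cb t ->
     F (fun y => maxe (s y) (t y)) <= e%:E + maxe (F s) (F t)) ->
  lsc phi -> lsc psi ->
  ext_lsc F (fun y => maxe (phi y) (psi y))
    <= e%:E + maxe (ext_lsc F phi) (ext_lsc F psi).
Proof.
move=> [[isoF _ _] ctsF _] maxF lphi lpsi.
apply: ge_ereal_sup => _ [t [Ct tle] <-].
(* Cutting at t keeps the limit of the approximations in Cb, where F is
   continuous. *)
pose p k := Cb_minorant d phi k; pose q k := Cb_minorant d psi k.
have Cp k : Cb (p k) by exact: Cb_Cb_minorant.
have Cq k : Cb (q k) by exact: Cb_Cb_minorant.
pose m k := fun y => maxe (p k y) (q k y).
have Cm k : Cb (m k) by exact: Cb_max.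
pose tm k := fun y => mine (m k y) (t y).
have Ctm k : Cb (tm k) by apply: Cb_min => //; case: (Cm k).
have cvg_tm : F (tm k) @[k --> \oo] --> F t.
  apply: ctsF => // [k y|y].
    rewrite le_min !ge_min lexx orbT andbT; apply/orP; left.
    by rewrite ge_max !le_max !Cb_minorant_nondecreasing // orbT.
  have pc := Cb_minorant_cvg d_metric d_top (y := y) lphi.
  have qc := Cb_minorant_cvg d_metric d_top (y := y) lpsi.
  apply: cvge_order => a at_.
    have : a%:E < maxe (phi y) (psi y) by exact: lt_le_trans (tle y).
    rewrite lt_max => /orP[/(cvge_gt_near pc)|/(cvge_gt_near qc)];
    by apply: filterS => k ak; rewrite lt_min at_ andbT lt_max ak ?orbT.
  by near=> k; rewrite gt_min at_ orbT.
apply: cvge_to_le cvg_tm _; apply: nearW => k.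
apply: le_trans (isoF _ _ (Ctm k) (Cm k) _) _.
  by move=> y; rewrite ge_min lexx.
apply: le_trans (maxF _ _ (Cp k) (Cq k)) _; rewrite leeD2l //.
have pF : F (p k) <= ext_lsc F phi.
  by apply: Cb_le_ext_lsc => // y; exact: (Cb_minorant_le d_metric).
have qF : F (q k) <= ext_lsc F psi.
  by apply: Cb_le_ext_lsc => // y; exact: (Cb_minorant_le d_metric).
by rewrite ge_max !le_max pF qF orbT.
Unshelve. all: by end_near. Qed.

(** The form in which the convergence of rho, the tightness and the bound on
    the total mass are used: eventual inequalities, stable under subsequences. *)
Definition asymptotically_maxplus Fs : Prop :=
  [/\ forall n, QL (Fs n),
      forall e : R, (0 < e)%R -> \forall n \near \oo,
        forall s t, Cb s -> Cb t ->
          Fs n (fun y => maxe (s y) (t y)) <= e%:E + maxe (Fs n s) (Fs n t),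
      forall r : R, exists2 K : set Y, compact K &
        \forall n \near \oo, ext_lsc (Fs n) (max_indic (~` K)) <= r%:E &
      exists M : R, \forall n \near \oo, Fs n (fun=> 0) <= M%:E].

Lemma asymptotically_maxplus_subseq Fs (s : nat -> nat) :
  {homo s : m n / (m < n)%N} ->
  asymptotically_maxplus Fs -> asymptotically_maxplus (fun k => Fs (s k)).
Proof.
move=> hs [qlF maxF tightF [M massF]]; split=> //.
- by move=> e e0; exact: (near_subseq hs (maxF e e0)).
- by move=> r; have [K cK hK] := tightF r; exists K => //; exact: (near_subseq hs hK).
- by exists M; exact: (near_subseq hs massF).
Qed.

(** These sets are stable under finite maxima, since rho tends to 0; this is the
    only trace of maxitivity that the limit arguments need. *)
Definition bounded_limsup Fs (t : R) : set (Y -> \bar R) :=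
  [set psi | lsc psi /\ limn_esup (fun n => ext_lsc (Fs n) psi) < t%:E].

Lemma bounded_limsup_near Fs (t r : R) psi : lsc psi -> (r < t)%R ->
  (\forall n \near \oo, ext_lsc (Fs n) psi <= r%:E) ->
  bounded_limsup Fs t psi.
Proof.
move=> lpsi rt h; split => //; apply: le_lt_trans (near_limn_esup_le h) _.
by rewrite lte_fin.
Qed.

Lemma bounded_limsup_max Fs (t : R) phi psi : asymptotically_maxplus Fs ->
  bounded_limsup Fs t phi -> bounded_limsup Fs t psi ->
  bounded_limsup Fs t (fun y => maxe (phi y) (psi y)).
Proof.
move=> [qlF maxF _ _] [lphi phit] [lpsi psit].
have : maxe (limn_esup (fun n => ext_lsc (Fs n) phi))
            (limn_esup (fun n => ext_lsc (Fs n) psi)) < t%:E.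
  by rewrite gt_max phit psit.
move=> /ereal_lt_split[r /andP[]]; rewrite gt_max => /andP[h1 h2] rt.
have e0 : (0 < (t - r) / 2)%R by move: rt; rewrite lte_fin; lra.
apply: (@bounded_limsup_near _ _ (r + (t - r) / 2)%R) => //.
- exact: lsc_max.
- by move: rt; rewrite lte_fin; lra.
have n1 := limn_esup_lt_near h1; have n2 := limn_esup_lt_near h2.
near=> n; apply: (@le_trans _ _ (((t - r) / 2)%:E + r%:E)); last first.
  by rewrite -EFinD addrC.
apply: le_trans (ext_lsc_max (e := (t - r) / 2) _ _ lphi lpsi) _ => //.
  by near: n; exact: maxF.
rewrite leeD2l // ge_max; apply/andP; split; apply: ltW; near: n; [exact: n1|exact: n2].
Unshelve. all: by end_near. Qed.

Lemma bounded_limsup_Ny Fs (t : R) : asymptotically_maxplus Fs ->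
  bounded_limsup Fs t (fun=> -oo).
Proof.
move=> [qlF _ _ _].
apply: (@bounded_limsup_near _ _ (t - 1)%R); [by apply: lsc_cst|lra|].
apply: nearW => n; rewrite (ext_lsc_Cb (qlF n)) ?(QL_Ny (qlF n)) ?leNye //; exact: Cb_cst.
Qed.

Lemma bounded_limsup_cst Fs (t : R) : asymptotically_maxplus Fs ->
  exists c : R, bounded_limsup Fs t (fun=> c%:E).
Proof.
move=> [qlF _ _ [M massF]]; exists (t - 1 - M)%R.
apply: (@bounded_limsup_near _ _ (t - 1)%R); [by apply: lsc_cst; rewrite ltry|lra|].
apply: filterS massF => n h.
rewrite (ext_lsc_Cb (qlF n)); last by apply: Cb_cst; rewrite ltry.
rewrite (QL_cst (t - 1 - M) (qlF n)).
apply: (@le_trans _ _ ((t - 1 - M)%:E + M%:E)); first by rewrite leeD2l.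
by rewrite -EFinD lee_fin; lra.
Qed.

Lemma compact_closed_metrizable (K : set Y) : compact K -> closed K.
Proof.
have [d_ge0 d_eq0 dC d_tri] := d_metric.
apply: compact_closed => x y cl; apply/d_eq0; apply/eqP.
rewrite eq_le d_ge0 andbT leNgt; apply/negP => dxy.
have e0 : (0 < d x y / 2)%R by lra.
have [z [/= xz yz]] := cl _ _ (near_dist d_top x e0) (near_dist d_top y e0).
by have := d_tri x z y; rewrite (dC z y); lra.
Qed.

(** The Varadhan upper bound in local form: by tightness and compactness,
    finitely many of the local majorants, together with a constant off a
    compact set, dominate phi globally. *)
Lemma locally_bounded_limsup Fs (t M : R) phi : asymptotically_maxplus Fs ->
  (forall y, phi y <= M%:E) ->
  (forall y : Y, exists2 psi, bounded_limsup Fs t psi &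
     \forall z \near y, phi z <= psi z) ->
  exists2 psi, bounded_limsup Fs t psi & forall y, phi y <= psi y.
Proof.
move=> amF phiM loc; have [qlF _ tightF _] := amF.
have [K cK hK] := tightF (t - 1 - M)%R.
(* Near-covering compactness, applied to [bounded_limsup Fs t] directed upwards,
   selects a single function that dominates phi on K. *)
pose G := filter_from (bounded_limsup Fs t)
  (fun psi => [set psi' | forall y, psi y <= psi' y]).
have FG : Filter G.
  apply: filter_from_filter; first by exists (fun=> -oo); exact: bounded_limsup_Ny.
  move=> p q gp gq; exists (fun y => maxe (p y) (q y)).
    exact: bounded_limsup_max.
  by move=> s /= hs; split => y; apply: le_trans (hs y); rewrite le_max lexx ?orbT.
have : \forall psi \near G, K `<=` (fun y => phi y <= psi y).
  apply: (proj1 (compact_near_coveringP K) cK) => // y _.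
  have [psi gpsi near_psi] := loc y.
  exists ([set z | phi z <= psi z], [set psi' | forall y, psi y <= psi' y]).
    by split => //=; exists psi.
  by move=> [z psi'] /= [h1 h2]; apply: le_trans h1 (h2 z).
move=> [psi gpsi hpsi].
have oK : open (~` K) by apply: closed_openC; exact: compact_closed_metrizable.
pose tail y := M%:E + max_indic (~` K) y.
exists (fun y => maxe (psi y) (tail y)).
  apply: bounded_limsup_max => //.
  apply: (@bounded_limsup_near _ _ (t - 1)%R); last 2 first.
  - lra.
  - apply: filterS hK => n h; apply: le_trans (ext_lsc_translate _ _ (qlF n)) _.
    apply: le_trans (leeD2l _ h) _; rewrite -EFinD lee_fin; lra.
  - by apply: lsc_translate; exact: lsc_max_indic.
move=> y; rewrite le_max; have [Ky|nKy] := pselect (K y).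
  by rewrite hpsi.
by rewrite /tail /max_indic mem_set // adde0 phiM orbT.
Qed.

Lemma locally_bounded_limn_esup Fs (t M : R) phi : asymptotically_maxplus Fs ->
  (forall y, phi y <= M%:E) ->
  (forall y : Y, exists2 psi, bounded_limsup Fs t psi &
     \forall z \near y, phi z <= psi z) ->
  limn_esup (fun n => ext (Fs n) phi) < t%:E.
Proof.
move=> amF phiM loc.
have [psi [lpsi psit] h] := locally_bounded_limsup amF phiM loc.
apply: le_lt_trans psit; apply: limn_esup_le_near; apply: nearW => n.
exact: ext_le_ext_lsc.
Qed.

End Forms.

(** * Forms with a density and weak sequential compactness *)

Section DensityForms.
Context {R : realType} {Y : topologicalType}.
Implicit Types (phi psi f : Y -> \bar R).

Lemma form_of_density_ge f phi y : phi y - f y <= form_of_density f phi.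
Proof. by apply: ereal_sup_ubound; exists y. Qed.

Lemma form_of_density_le f phi a : (forall y, phi y - f y <= a) ->
  form_of_density f phi <= a.
Proof. by move=> h; apply: ge_ereal_sup => _ [y _ <-]. Qed.

Lemma form_of_density_gt f phi a : a < form_of_density f phi ->
  exists y, a < phi y - f y.
Proof. by move=> /ereal_sup_gt[_ [y _ <-] h]; exists y. Qed.

Lemma Lin_form_of_density f (m : R) : (forall y, m%:E <= f y) ->
  Lin (form_of_density f).
Proof.
move=> mf.
have mono phi psi : (forall y, phi y <= psi y) ->
    form_of_density f phi <= form_of_density f psi.
  move=> h; apply: form_of_density_le => y.
  by apply: le_trans (form_of_density_ge f psi y); exact: leeB.
have max0 : quasi_max_constants (form_of_density f) 0.
  split=> [|phi psi _ _]; first exact: ltry.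
  rewrite add0e; apply: form_of_density_le => y; rewrite le_max.
  by case: (leP (phi y) (psi y)) => _; rewrite form_of_density_ge ?orbT.
split; last exact: ereal_inf_lbound.
split.
- split; [by move=> phi psi _ _; exact: mono| |by exists 0].
  move=> lam phi lamy _; apply/eqP; rewrite eq_le; apply/andP; split.
    by apply: form_of_density_le => y; rewrite -addeA leeD2l // form_of_density_ge.
  case: lam lamy => [l| |] // _; last by rewrite addNye leNye.
  rewrite -leeBrDl //; apply: form_of_density_le => y; rewrite leeBrDl //.
  by rewrite addeA; exact: (form_of_density_ge f (fun y => l%:E + phi y)).
- move=> phis phi Cphis Cphi nd cvg_phis.
  apply: cvge_order => a ha.
    have [y hy] := form_of_density_gt ha.
    have fy : f y \is a fin_num.
      move: (mf y) hy; case: (f y) => //.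
      by rewrite addeNy.
    move: hy; rewrite lteBrDr // => /(cvge_gt_near (cvg_phis y)).
    apply: filterS => k; rewrite -lteBrDr // => /lt_le_trans; apply.
    exact: form_of_density_ge.
  apply: nearW => k; apply: le_lt_trans ha; apply: mono => y.
  apply: cvge_to_ge (cvg_phis y) _; exists k => // n /= kn.
  rewrite -(subnK kn); elim: (n - k)%N => // i IH.
  by rewrite addSn; apply: le_trans IH (nd _ _).
- move=> phi [_ [M phiM]]; apply: (@le_lt_trans _ _ (M%:E - m%:E)).
    by apply: form_of_density_le => y; exact: leeB.
  by rewrite -EFinB ltry.
Qed.

End DensityForms.

(** Cantor's diagonal extraction, obtained from Tychonoff's theorem for the
    compressed sequences. *)
Lemma ereal_diagonal_extraction {R : realType} (a : nat -> nat -> \bar R) :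
  exists2 s : nat -> nat, {homo s : m n / (m < n)%N} &
  exists p : nat -> \bar R, forall j, a (s k) j @[k --> \oo] --> p j.
Proof.
pose c n : forall j : nat, R := fun j => contract (a n j).
have := @tychonoff nat (fun=> R : topologicalType) (fun=> `[(-1)%R, 1%R]%classic)
  (fun=> @segment_compact R (-1)%R 1%R).
move=> /(_ (c @ \oo) _)[|q [_ clq]].
  exists 0%N => // n _ j /=; rewrite in_itv /=.
  by have := contract_le1 (a n j); rewrite ler_norml.
have near_q k (e : R) : (0 < e)%R ->
    nbhs q [set f : forall j : nat, R | forall j, (j < k)%N -> (`|q j - f j| < e)%R].
  move=> e0; elim: k => [|k IH]; first by apply: filterS filterT => f _ j.
  have pk : nbhs q [set f : forall j : nat, R | (`|q k - f k| < e)%R].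
    have := @proj_continuous nat (fun=> R : topologicalType) k q
      [set r : R | (`|q k - r| < e)%R].
    by apply; apply/nbhs_ballP; exists e.
  apply: filterS2 IH pk => f h1 h2 j; rewrite ltnS leq_eqVlt => /orP[/eqP->//|].
  exact: h1.
have hP (kN : nat * nat) : exists n, (kN.2 <= n)%N /\
    forall j, (j < kN.1)%N -> (`|q j - c n j| < kN.1.+1%:R^-1)%R.
  have : (c @ \oo) (c @` [set n | (kN.2 <= n)%N]).
    by exists kN.2 => // n /= Nn; exists n.
  move=> /clq /(_ (near_q kN.1 _ _)) /=.
  by move=> /(_ (kN.1.+1%:R^-1)%R)[|_ [[n Nn <-] h]]; [rewrite invr_gt0|exists n].
have [h hh] := choice hP.
(* After step k the first k coordinates are within 1 / (k + 1) of the cluster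
   point. *)
pose s := fix s k := if k is k'.+1 then h (k, (s k').+1) else h (0%N, 0%N).
have s_spec k j : (j < k)%N -> (`|q j - c (s k) j| < k.+1%:R^-1)%R.
  by case: k => // k jk; exact: (hh (k.+1, (s k).+1)).2.
exists s.
  by apply: homo_ltn => [? ? ?|k]; [exact: ltn_trans|exact: (hh (k.+1, (s k).+1)).1].
exists (fun j => expand (q j)) => j.
have near_s (e : R) : (0 < e)%R -> \forall k \near \oo, (`|q j - c (s k) j| < e)%R.
  move=> e0; exists (maxn j.+1 (Num.truncn e^-1)) => // k /=.
  rewrite geq_max => /andP[jk ek]; apply: lt_trans (s_spec k j jk) _.
  rewrite -[e]invrK ltf_pV2 ?posrE ?invr_gt0 //.
  by apply: lt_le_trans (Num.Theory.truncnS_gt _) _; rewrite ler_nat ltnS.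
apply: cvge_order => b; rewrite ?lt_expand_contract ?gt_expand_contract => hb.
  have : (0 < q j - contract b%:E)%R by lra.
  move=> /near_s; apply: filterS => k; rewrite ltr_distl => /andP[h1 h2].
  by rewrite -lt_contract; rewrite /c in h1 h2; lra.
have : (0 < contract b%:E - q j)%R by lra.
move=> /near_s; apply: filterS => k; rewrite ltr_distl => /andP[h1 h2].
by rewrite -lt_contract; rewrite /c in h1 h2; lra.
Qed.

Section WeakCompactness.
Context {R : realType} {Y : topologicalType}.
Implicit Types (phi psi f : Y -> \bar R) (Fs : nat -> (Y -> \bar R) -> \bar R).
Context (d : Y -> Y -> R) (d_metric : is_metric d) (d_top : metrizes d).

Lemma countable_base (D : set Y) : countable D -> dense D ->
  exists2 U : nat -> set Y, (forall j, open (U j)) &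
    forall y A, nbhs y A -> exists2 j, U j y & U j `<=` A.
Proof.
have [d_ge0 d_eq0 dC d_tri] := d_metric.
move=> /countable_injP[c c_inj] denseD.
have openB x (e : R) : open [set z | (d x z < e)%R].
  rewrite openE => z /= xz; have e0 : (0 < e - d x z)%R by lra.
  by apply: filterS (near_dist d_top z e0) => w /= zw; have := d_tri x z w; lra.
pose U j := if @unpickle (nat * nat)%type j is Some (i, m) then
  \bigcup_(x in [set x | D x /\ c x = i]) [set z | (d x z < m.+1%:R^-1)%R] else set0.
exists U.
  move=> j; rewrite /U; case: unpickle => [[i m]|]; last exact: open0.
  exact: bigcup_open.
move=> y A /d_top[e e0 hA].
pose m := Num.truncn (2 / e).
have me : (m.+1%:R^-1 < e / 2)%R.
  rewrite -[(e / 2)%R]invrK ltf_pV2 ?posrE ?invr_gt0 ?divr_gt0 // invf_div.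
  exact: Num.Theory.truncnS_gt.
have m0 : (0 < m.+1%:R^-1 :> R)%R by rewrite invr_gt0.
have [x [/= yx Dx]] : [set z | (d y z < m.+1%:R^-1)%R] `&` D !=set0.
  apply: denseD; last exact: openB.
  by exists y; rewrite /= (proj2 (d_eq0 y y) erefl).
(* The ball of radius 1 / (m + 1) around the dense point x. *)
exists (pickle (c x, m)); rewrite /U pickleK; first by exists x => //=; rewrite dC.
move=> z [x' [Dx' /c_inj]]; rewrite !inE => /(_ Dx' Dx) -> /= xz.
apply: hA => /=; apply: le_lt_trans (d_tri y x z) _.
by apply: lt_trans (ltrD yx xz) _; rewrite [ltRHS]splitr ltrD.
Qed.

(** The Prokhorov theorem for asymptotically max-plus sequences: along a
    diagonal subsequence the masses of all basic open sets U converge, and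
    minus the infimum of these limits over the basic neighbourhoods of y is
    the density at y. *)
Lemma weak_sequential_compactness Fs (D : set Y) : countable D -> dense D ->
  asymptotically_maxplus Fs ->
  exists2 s : nat -> nat, {homo s : m n / (m < n)%N} &
  exists f, [/\ lower_semicontinuous f, exists m : R, forall y, m%:E <= f y &
                weak_cvg (fun k => Fs (s k)) (form_of_density f)].
Proof.
move=> cD dD amF; have [U oU baseU] := countable_base cD dD.
have [s hs [p hp]] := ereal_diagonal_extraction
  (fun n j => ext_lsc (Fs n) (max_indic (U j))).
exists s => //.
have amFs := asymptotically_maxplus_subseq hs amF.
have [qlF _ _ [M massF]] := amFs.
pose f y := ereal_sup [set - p j | j in [set j | U j y]].
have f_ge j y : U j y -> - p j <= f y by move=> ?; apply: ereal_sup_ubound; exists j.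
have nbhsU j y : U j y -> nbhs y (U j) by move=> ?; exact: open_nbhs_nbhs.
have p_le j : p j <= M%:E.
  apply: cvge_to_le (hp j) _; apply: filterS massF => n; apply: le_trans.
  rewrite -(ext_lsc_Cb (qlF n)); last by apply: Cb_cst; rewrite ltry.
  by apply: ext_lsc_le => y; rewrite /max_indic; case: ifP => // _; rewrite leNye.
have f_ge_M y : (- M)%:E <= f y.
  have [j Uj _] := baseU y setT filterT.
  by apply: le_trans (f_ge j y Uj); rewrite EFinN leeN2.
exists f; split; last first.
- move=> phi Cphi; have [cphi [N phiN]] := Cphi.
  apply: cvge_order => a ha.
    (* Lower bound: phi > c on a basic neighbourhood of a point y where
       phi - f exceeds a, so that F_n(phi) >= c + F_n(1_U). *)
    have [y] := form_of_density_gt ha.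
    have fy_le := f_ge_M y; have fyE : f y = +oo \/ f y \is a fin_num.
      by move: fy_le; case: (f y) => [r| |] // _; [right|left].
    case: fyE => [->|fy]; first by rewrite addeNy.
    rewrite lteBrDr // => /ereal_lt_split[c /andP[afc cphiy]].
    have [j Ujy Uj_c] := baseU y _ (cvge_gt_near (cphi y) cphiy).
    have apj : (a - c)%:E < p j.
      have : - f y <= p j by rewrite leeNl f_ge.
      apply: lt_le_trans; rewrite -(fineK fy) -EFinN lte_fin.
      by move: afc; rewrite -(fineK fy) -EFinD lte_fin; lra.
    apply: filterS (cvge_gt_near (hp j) apj) => k hk.
    rewrite -(ext_lsc_Cb (qlF k) Cphi).
    have : ext_lsc (Fs (s k)) (max_indic (U j)) <=
           (- c)%:E + ext_lsc (Fs (s k)) phi.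
      apply: (@le_trans _ _ (ext_lsc (Fs (s k)) (fun z => (- c)%:E + phi z))).
        apply: ext_lsc_le => z; rewrite /max_indic; case: ifPn => [/set_mem Uz|_].
          by rewrite EFinN addeC leeBrDr // add0e; apply: ltW; exact: Uj_c.
        by rewrite leNye.
      exact: ext_lsc_translate.
    move=> /(lt_le_trans hk); rewrite EFinN addeC lteBrDr // -EFinD.
    by rewrite subrK.
  (* Upper bound: near y, phi is dominated by c + 1_U with c slightly above
     phi y and the limit mass of U slightly above - f y. *)
  suff : limn_esup (fun k => ext (Fs (s k)) phi) < a%:E.
    move=> /limn_esup_lt_near; apply: filterS => k.
    by rewrite ext_lscE ?ext_lsc_Cb //; exact: Cb_lsc.
  apply: (locally_bounded_limn_esup d_metric d_top amFs phiN) => y.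
  have [phiy|] := eqVneq (phi y) -oo.
    have [c hc] := bounded_limsup_cst a amFs; exists (fun=> c%:E) => //.
    have : phi y < c%:E by rewrite phiy ltNyr.
    by move=> /(cvge_lt_near (cphi y)); apply: filterS => z /ltW.
  move=> phiy; have [r rE] : exists r : R, phi y = r%:E.
    by move: phiy (phiN y); case: (phi y) => [r| |] // _ _; exists r.
  have : (r - a)%:E < f y.
    have := le_lt_trans (form_of_density_ge f phi y) ha; rewrite rE.
    case: (f y) (f_ge_M y) => [v _| |] //; last by rewrite ltry.
    by rewrite -EFinB !lte_fin; lra.
  move=> /ereal_sup_gt[_ [j Ujy <-]]; rewrite lteNr -EFinN.
  move=> /ereal_lt_split[q /andP[pq qa]]; rewrite lte_fin in qa.
  pose c := (r + (a - r - q) / 2)%R.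
  exists (fun z => c%:E + max_indic (U j) z).
    apply: (@bounded_limsup_near _ _ _ _ (c + q)%R).
    - by apply: lsc_translate; exact: lsc_max_indic.
    - by rewrite /c; lra.
    - apply: filterS (cvge_lt_near (hp j) pq) => k hk.
      apply: le_trans (ext_lsc_translate _ _ (qlF k)) _.
      by rewrite (EFinD c q) leeD2l // ltW.
  have phic : phi y < c%:E by rewrite rE lte_fin /c; lra.
  apply: filterS2 (nbhsU j y Ujy) (cvge_lt_near (cphi y) phic) => z Uz /ltW h.
  by rewrite /max_indic mem_set // adde0.
- by exists (- M)%R.
- apply: near_lsc => y a /ereal_sup_gt[_ [j Ujy <-] aj].
  by apply: filterS (nbhsU j y Ujy) => z /f_ge; exact: lt_le_trans.
Qed.

End WeakCompactness.

(** * The kernel: subgradients, conjugates and densities *)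

Section Kernel.
Context {R : realType} {X Y : topologicalType}.
Implicit Types (psi phi f : Y -> \bar R) (Fs : nat -> (Y -> \bar R) -> \bar R).
Context (d : Y -> Y -> R) (d_metric : is_metric d) (d_top : metrizes d).
Context (b : X -> Y -> \bar R).
Hypothesis b_lsc : forall x, lsc (b x).

Lemma conjugate_ge g x y : b x y - g x <= conjugate b g y.
Proof. by apply: ereal_sup_ubound; exists x. Qed.

Lemma subdiff_conjugate g x y : subdiff b g x y ->
  conjugate b g y = b x y - g x.
Proof.
move=> [_ hy]; apply/eqP; rewrite eq_le conjugate_ge andbT.
by apply: ge_ereal_sup => _ [x' _ <-].
Qed.

Lemma bounded_limsup_translate_kernel Fs g x (t q c : R) :
  asymptotically_maxplus Fs ->
  g x = limn_esup (fun n => ext_lsc (Fs n) (b x)) ->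
  g x < q%:E -> (c + q < t)%R ->
  bounded_limsup Fs t (fun z => c%:E + b x z).
Proof.
move=> [qlF _ _ _] gE gq cqt.
apply: (@bounded_limsup_near _ _ _ _ (c + q)%R) => //; first exact: lsc_translate.
have : limn_esup (fun n => ext_lsc (Fs n) (b x)) < q%:E by rewrite -gE.
move=> /limn_esup_lt_near; apply: filterS => n /ltW h.
apply: le_trans (ext_lsc_translate _ _ (qlF n)) _.
by rewrite EFinD leeD2l.
Qed.

Lemma bounded_limsup_finite Fs (t : R) (I : eqType) (r : seq I)
    (h : I -> Y -> \bar R) : asymptotically_maxplus Fs ->
  (forall i, i \in r -> bounded_limsup Fs t (h i)) ->
  exists2 psi, bounded_limsup Fs t psi &
    forall i y, i \in r -> h i y <= psi y.
Proof.
move=> amF; elim: r => [_|i r IH hr].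
  by exists (fun=> -oo) => //; exact: bounded_limsup_Ny.
have [|psi hpsi psi_ge] := IH; first by move=> j jr; apply: hr; rewrite inE jr orbT.
exists (fun y => maxe (h i y) (psi y)).
  by apply: (bounded_limsup_max d_metric d_top) => //; apply: hr; rewrite inE eqxx.
move=> j y; rewrite inE => /orP[/eqP->|/psi_ge]; first by rewrite le_max lexx.
by move=> /(_ y) jy; rewrite le_max jy orbT.
Qed.

(** Upper coercivity replaces the unbounded function b x by its truncation:
    where b x is large it is dominated by b z - beta for one of finitely many
    z near x, and these have mass less than g x as soon as beta exceeds the
    local oscillation of g. *)
Lemma upper_coercive_truncation Fs g x :
  asymptotically_maxplus Fs ->
  (forall x', g x' = limn_esup (fun n => ext_lsc (Fs n) (b x'))) ->
  upper_coercive b -> idom g x ->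
  exists (M : R) psi, bounded_limsup Fs (fine (g x)) psi /\
    forall y, b x y <= maxe (mine (b x y) M%:E) (psi y).
Proof.
move=> amF gE ucb [/= gx /ereal_inf_lt[_ [V xV <-]]].
move=> /ereal_lt_split[C /andP[VC _]].
have gV z : V z -> g z < C%:E.
  by move=> Vz; apply: le_lt_trans VC; apply: ereal_sup_ubound; exists z.
have [W [/finite_seqP[r ->] rV hW]] := ucb x V xV.
(* With this beta, b z - beta has limiting mass at most g x - 1. *)
pose beta := (C - fine (g x) + 1)%R; have [M hM] := hW beta.
have [z zr|psi hpsi psi_ge] :=
    @bounded_limsup_finite Fs (fine (g x)) X r (fun z y => (- beta)%:E + b z y) amF.
  apply: (bounded_limsup_translate_kernel amF (gE z) (gV z _)).
    exact: rV.
  by rewrite /beta; lra.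
exists M, psi; split => // y; rewrite le_max le_min lexx /=.
have [//|My] := leP (b x y) M%:E; rewrite /=.
have bxy : b x y \is a fin_num.
  by have [/(_ y) + _] := b_lsc x; move: My; case: (b x y).
have : ~ relative_kernel b x [set` r] y <= beta%:E by move/hM; rewrite leNgt My.
move/negP; rewrite -ltNge lteBrDr // => /ereal_sup_gt[_ [z /= zr <-]] /ltW h.
by apply: le_trans (psi_ge z y zr); rewrite EFinN addeC leeBrDr // addeC.
Qed.

(** For x in idom g, the mass g x of b x is carried by some subgradient of g
    at x. Away from the subgradients b x is locally dominated by a translate
    of another b x', of mass less than g x; so if every subgradient also had
    such a local majorant, the local upper bound would give g x < g x. *)
Lemma exists_charged_subgradient Fs g x :
  asymptotically_maxplus Fs ->
  (forall x', g x' = limn_esup (fun n => ext_lsc (Fs n) (b x'))) ->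
  continuous (b x) -> upper_coercive b -> idom g x ->
  exists2 y, subdiff b g x y &
    forall psi, bounded_limsup Fs (fine (g x)) psi ->
      ~ \forall z \near y, b x z <= psi z.
Proof.
move=> amF gE cbx ucb gx; apply: contrapT => none.
have [M [psi1 [hpsi1 le1]]] := upper_coercive_truncation amF gE ucb gx.
have {gx} gx : g x \is a fin_num by case: gx.
have gxE := fineK gx; set gam := fine (g x) in gxE hpsi1 none.
have [y|y|psi2 hpsi2 le2] := @locally_bounded_limsup _ _ _ d_metric d_top Fs gam M
    (fun y => mine (b x y) M%:E) amF.
- by rewrite ge_min lexx orbT.
- suff [psi hpsi near_psi] : exists2 psi, bounded_limsup Fs gam psi &
      \forall z \near y, b x z <= psi z.
    by exists psi => //; apply: filterS near_psi => z h; rewrite ge_min h.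
  have [bxy|bxy] := eqVneq (b x y) -oo.
    have [c hc] := bounded_limsup_cst gam amF; exists (fun=> c%:E) => //.
    have : b x y < c%:E by rewrite bxy ltNyr.
    by move=> /(cvge_lt_near (cbx y)); apply: filterS => z /ltW.
  have {}bxy : b x y \is a fin_num.
    by have [/(_ y) + _] := b_lsc x; move: bxy; case: (b x y).
  have [sub_y|nsub_y] := pselect (subdiff b g x y).
    apply: contrapT => none_y; apply: none; exists y => // psi hpsi near_psi.
    by apply: none_y; exists psi.
  have [x' hx'] : exists x', b x y - g x < b x' y - g x'.
    apply: contrapT => hn; apply: nsub_y; split => // x'.
    by rewrite leNgt; apply/negP => h; apply: hn; exists x'.
  move: hx'; rewrite -gxE -(fineK bxy) -EFinB; set r := fine (b x y) => hx'.
  have bx'y : b x' y \is a fin_num.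
    have [/(_ y) + _] := b_lsc x'; move: hx'; case: (b x' y) => //.
  have : g x' < (fine (b x' y) - r + gam)%:E.
    move: hx'; rewrite -(fineK bx'y) /=; case: (g x') => [v| |] //.
      by rewrite -EFinB !lte_fin; lra.
    by rewrite ltNyr.
  move=> /ereal_lt_split[q /andP[gq]]; rewrite lte_fin; set r' := fine _ => qlt.
  (* c > r - r' makes c + b x' exceed b x at y, and c < gam - q keeps its
     limiting mass below g x. *)
  pose c := ((r - r' + (gam - q)) / 2)%R.
  exists (fun z => c%:E + b x' z).
    by apply: (bounded_limsup_translate_kernel amF (gE x') gq); rewrite /c; lra.
  pose m := ((r + (c + r')) / 2)%R.
  have bm : b x y < m%:E by rewrite -(fineK bxy) lte_fin /m /c -/r; lra.
  have b'm : (m - c)%:E < b x' y by rewrite -(fineK bx'y) lte_fin /m /c -/r'; lra.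
  apply: filterS2 (cvge_lt_near (cbx y) bm) (lsc_near (b_lsc x').2 b'm) => z /ltW h1.
  by rewrite EFinB lteBlDr // addeC => /ltW; apply: le_trans.
have [lpsi] := bounded_limsup_max d_metric d_top amF hpsi1 hpsi2.
apply/negP; rewrite -leNgt gxE gE; apply: limn_esup_le_near; apply: nearW => n.
apply: ext_lsc_le => y; apply: le_trans (le1 y) _.
by rewrite ge_max !le_max le2 lexx orbT.
Qed.

(** The adjunction between b x - f <= g x and b x - g x <= f: the first
    inequality holds because b x is a supremum of functions of Cb, at which the
    limit F is dominated by g x. *)
Lemma conjugate_le_density Fs g F f (s : nat -> nat) :
  (forall n, QL (Fs n)) ->
  (forall x, g x = limn_esup (fun n => ext_lsc (Fs n) (b x))) ->
  {homo s : m n / (m < n)%N} -> weak_cvg (fun k => Fs (s k)) F ->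
  lsc_density F f -> forall y, conjugate b g y <= f y.
Proof.
move=> qlF gE hs cvgF [_ Ff] y; apply: ge_ereal_sup => _ [x _ <-].
have F_le psi : Cb psi -> (forall z, psi z <= b x z) -> F psi <= g x.
  move=> Cpsi h; rewrite leNgt; apply/negP => /ereal_lt_split[v /andP[gv vF]].
  have := gv; rewrite gE => /limn_esup_lt_near/(near_subseq hs) n1.
  have n2 : \forall k \near \oo, v%:E < Fs (s k) psi.
    exact: cvge_gt_near (cvgF _ Cpsi) vF.
  have [k [k1 k2]] := filter_ex (filterI n1 n2).
  have := lt_trans k1 k2; apply/negP; rewrite -leNgt.
  exact: Cb_le_ext_lsc.
rewrite leNgt; apply/negP => /ereal_lt_split[q /andP[fq]].
have [bxy|bxy] := eqVneq (b x y) -oo; first by rewrite bxy.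
have {}bxy : b x y \is a fin_num.
  by have [/(_ y) + _] := b_lsc x; move: bxy; case: (b x y).
move=> hq.
have : g x < (fine (b x y) - q)%:E.
  move: hq; rewrite -(fineK bxy) /=; case: (g x) => [v| |] //.
    by rewrite -EFinB !lte_fin; lra.
  by rewrite ltNyr.
move=> /ereal_lt_split[v /andP[gv vb]].
have : (v + q)%:E < b x y by move: vb; rewrite -(fineK bxy) !lte_fin; lra.
move=> /(lsc_minorant_gt d_metric d_top (b_lsc x))[psi [Cpsi psi_le psi_gt]].
have := F_le psi Cpsi psi_le; rewrite leNgt => /negP; apply.
apply: lt_trans gv _; rewrite (Ff _ Cpsi).
apply: lt_le_trans (form_of_density_ge f psi y).
move: psi_gt fq; case: (psi y) => [u| |] //; last first.
  by case: (f y) => [w| |] // _ _; rewrite ?addye // ltry.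
case: (f y) => [w| |] //; last by rewrite ltry.
by rewrite -EFinB !lte_fin; lra.
Qed.

(** At a point y of C where - Bg y < t, the indicator of C is dominated near y
    by b x - c for some x nearly attaining Bg y and some c just below b x y. *)
Lemma limn_esup_closed_le Fs g (C : set Y) :
  asymptotically_maxplus Fs ->
  (forall x, g x = limn_esup (fun n => ext_lsc (Fs n) (b x))) ->
  closed C ->
  limn_esup (fun n => ext (Fs n) (max_indic C)) <=
    form_of_density (conjugate b g) (max_indic C).
Proof.
move=> amF gE cC; rewrite leNgt; apply/negP => /ereal_lt_split[t /andP[ht]].
apply/negP; rewrite -leNgt; apply: ltW.
apply: (@locally_bounded_limn_esup _ _ _ d_metric d_top Fs t 0%R) => // y.
  by rewrite /max_indic; case: ifP => // _; rewrite leNye.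
have [Cy|nCy] := pselect (C y); last first.
  exists (fun=> -oo); first exact: bounded_limsup_Ny.
  have : nbhs y (~` C) by apply: open_nbhs_nbhs; split => //; exact: closed_openC.
  by apply: filterS => z nCz; rewrite /max_indic memNset.
have : (- t)%:E < conjugate b g y.
  have := le_lt_trans (form_of_density_ge _ _ y) ht.
  by rewrite /max_indic mem_set // add0e EFinN lteNl.
move=> /ereal_sup_gt[_ [x _ <-]] hx.
have bxy : b x y \is a fin_num.
  by have [/(_ y) + _] := b_lsc x; move: hx; case: (b x y).
have : g x < (fine (b x y) + t)%:E.
  move: hx; rewrite -(fineK bxy) /=; case: (g x) => [v| |] //.
    by rewrite -EFinB !lte_fin; lra.
  by rewrite ltNyr.
move=> /ereal_lt_split[q /andP[gq]]; rewrite lte_fin => qb.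
pose c := ((q - t + fine (b x y)) / 2)%R.
exists (fun z => (- c)%:E + b x z).
  by apply: (bounded_limsup_translate_kernel amF (gE x) gq); rewrite /c; lra.
have cb : c%:E < b x y by rewrite -(fineK bxy) lte_fin /c; lra.
apply: filterS (lsc_near (b_lsc x).2 cb) => z /ltW cz.
apply: (@le_trans _ _ 0); last by rewrite EFinN addeC sube_ge0.
by rewrite /max_indic; case: ifP => // _; rewrite leNye.
Qed.

(** When g is the full limit, the accumulation point F has the same values
    g x, so the mass of b x sits at a subgradient y where f does not exceed
    Bg y: otherwise a bump function near y, whose F-mass is read off f, would
    be a local majorant of b x of mass less than g x. *)
Lemma subgradient_of_equality Fs g F f (s : nat -> nat) x :
  asymptotically_maxplus Fs ->
  (forall x, g x = limn_esup (fun n => ext_lsc (Fs n) (b x))) ->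
  (forall x, ext_lsc (Fs n) (b x) @[n --> \oo] --> g x) ->
  (forall x, continuous (b x)) -> upper_coercive b ->
  {homo s : m n / (m < n)%N} -> weak_cvg (fun k => Fs (s k)) F ->
  lsc_density F f -> idom g x ->
  exists y, [/\ subdiff b g x y, conjugate b g y \is a fin_num &
                f y = conjugate b g y].
Proof.
move=> amF gE glim cb ucb hs cvgF Ff gx; have [lf FE] := Ff.
have amFs := asymptotically_maxplus_subseq hs amF; have [qlF _ _ _] := amF.
have gEs x' : g x' = limn_esup (fun k => ext_lsc (Fs (s k)) (b x')).
  have : ext_lsc (Fs (s k)) (b x') @[k --> \oo] --> g x'.
    exact: (cvg_comp _ _ (subseq_cvg hs) (glim x')).
  by move=> /cvg_limn_einf_sup[_ ->].
have [y sub_y charged_y] := exists_charged_subgradient amFs gEs (cb x) ucb gx.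
have BgE := subdiff_conjugate sub_y.
have bxy : b x y \is a fin_num by case: sub_y.
have {gx}gx : g x \is a fin_num by case: gx.
exists y; split => //; first by rewrite BgE fin_numB bxy.
apply/eqP; rewrite eq_le (conjugate_le_density qlF gE hs cvgF Ff) andbT leNgt.
apply/negP => /ereal_lt_split[c1 /andP[]]; rewrite BgE -(fineK bxy) -(fineK gx).
set r := fine (b x y); set gam := fine (g x) => rc1 c1f; rewrite lte_fin in rc1.
(* The gap c1 - (r - gam) is split into four: near y the bump may fall and b x
   may rise by del, the limit mass of the bump is known up to del, and one del
   remains. *)
pose del := ((c1 - (r - gam)) / 4)%R; have del0 : (0 < del)%R by rewrite /del; lra.
pose U := [set z | c1%:E < f z].
have oU : open U by move/lower_semicontinuousP : lf; exact.
have : (- del)%:E < max_indic U y by rewrite /max_indic mem_set // lte_fin; lra.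
move=> /(lsc_minorant_gt d_metric d_top (lsc_max_indic oU))[psi [Cpsi psi_le psi_y]].
have Fpsi : F psi < (- c1 + del)%:E.
  apply: (@le_lt_trans _ _ (- c1)%:E); last by rewrite lte_fin; lra.
  rewrite (FE _ Cpsi); apply: form_of_density_le => z.
  have := psi_le z; rewrite /max_indic; case: ifPn => [/set_mem Uz h|_].
    by rewrite EFinN -[leRHS]add0e; apply: leeB => //; exact: ltW.
  by rewrite leeNy_eq => /eqP ->; rewrite addNye leNye.
apply: (charged_y (fun z => (r + 2 * del)%:E + psi z)).
  apply: (@bounded_limsup_near _ _ _ _ (r + 2 * del + (- c1 + del))%R).
  - by apply: lsc_translate; exact: Cb_lsc.
  - by rewrite -/gam /del; lra.
  - apply: filterS (cvge_lt_near (cvgF _ Cpsi) Fpsi) => k /ltW hk.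
    apply: le_trans (ext_lsc_translate _ _ (qlF (s k))) _.
    by rewrite (ext_lsc_Cb (qlF (s k)) Cpsi) (EFinD (r + 2 * del)) leeD2l.
have br : b x y < (r + del)%:E by rewrite -(fineK bxy) lte_fin -/r; lra.
have psi_near : \forall z \near y, (- del)%:E < psi z.
  exact: cvge_gt_near (Cpsi.1 y) psi_y.
apply: filterS2 (cvge_lt_near (cb x y) br) psi_near => z /ltW h1 /ltW h2.
apply: le_trans h1 _; apply: (@le_trans _ _ ((r + 2 * del)%:E + (- del)%:E)).
  by rewrite -EFinD lee_fin; lra.
by rewrite leeD2l.
Qed.

(** Let S be the set where f and Bg coincide and are finite; it covers idom g.
    If Bg y < a < f y at a point y with only topologically essential points of
    edom Bg in a neighbourhood, quasi-continuity provides,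
    close to y, a relatively open set where Bg < a < f and which contains a
    topologically essential point, hence a point of S: a contradiction. *)
Lemma density_eq_on_essential Fs g F f (s : nat -> nat) :
  asymptotically_maxplus Fs ->
  (forall x, g x = limn_esup (fun n => ext_lsc (Fs n) (b x))) ->
  (forall x, ext_lsc (Fs n) (b x) @[n --> \oo] --> g x) ->
  (forall x, continuous (b x)) -> upper_coercive b ->
  quasi_continuous_on_dom (conjugate b g) ->
  {homo s : m n / (m < n)%N} -> weak_cvg (fun k => Fs (s k)) F ->
  lsc_density F f ->
  let Bg := conjugate b g in
  let Phi := inv_subdiff b g in
  forall y, (alg_essential (ldom Bg) Phi (idom g) `|`
             relative_interior (edom Bg)
               (top_essential (ldom Bg) Phi (idom g))) y -> f y = Bg y.
Proof.
move=> amF gE glim cb ucb qcBg hs cvgF Ff Bg Phi y.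
have [qlF _ _ _] := amF; have [lf _] := Ff.
have Bgf := conjugate_le_density qlF gE hs cvgF Ff.
have cover x := subgradient_of_equality amF gE glim cb ucb hs cvgF Ff (x := x).
case=> [[_ y_ess]|[u u_int uy]].
  apply: contrapT => fy; apply: y_ess => x /cover[y' [sub_y' Bgy' fy']].
  exists y' => //; split; first by move: Bgy'; rewrite fin_numE /ldom/= ltey => /andP[].
  by move=> y'y; apply: fy; rewrite -y'y.
have Dy : edom Bg y by rewrite -uy; exact: set_valP.
apply/eqP; rewrite eq_le Bgf andbT leNgt.
apply/negP => /ereal_lt_split[a /andP[Bga af]].
have Gopen := @open_ereal_lt_ereal R a%:E.
have Bgu : Bg (set_val u) < a%:E by rewrite uy.
have u_cl := qcBg _ Gopen u Bgu.
have af_near : nbhs u [set v : edom Bg | a%:E < f (set_val v)].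
  have := @initial_continuous (edom Bg) Y set_val u [set z | a%:E < f z]; apply.
  by rewrite uy; exact: lsc_near.
have [v [v_int [v_ess av]]] := u_cl _ (filterI u_int af_near).
move: v_int; rewrite /interior/= nbhsE => -[_ [[B oB <-] Bv] BP].
have [_ v_top] := v_ess.
apply: (v_top (B `&` [set z | a%:E < f z])).
- by apply: openI => //; move/lower_semicontinuousP : lf; exact.
- by split.
move=> x /cover[y' [sub_y' Bgy' fy']].
exists y' => //; split; first by move: Bgy'; rewrite fin_numE /ldom/= ltey => /andP[].
move=> [By' /=]; rewrite fy'; apply/negP; rewrite -leNgt; apply: ltW.
have Dy' : y' \in edom Bg by rewrite inE.
exact: (BP (SigSub Dy')).
Qed.

End Kernel.

(** * Proof of the theorem *)

Section Assembly.
Context {R : realType} {Y : topologicalType}.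
Implicit Types (Fs : nat -> (Y -> \bar R) -> \bar R).

Lemma asymptotically_maxplus_of_tight (d : Y -> Y -> R) Fs :
  is_metric d -> metrizes d -> (forall n, QL (Fs n)) ->
  asymptotically_tight Fs ->
  limn_esup (fun n => ext (Fs n) (max_indic [set: Y])) < +oo ->
  rho (Fs n) @[n --> \oo] --> (0 : \bar R) ->
  asymptotically_maxplus Fs.
Proof.
move=> d_metric d_top qlF [_ tightF] massF rhoF; split => //.
- move=> e e0; have e0' : (0 : \bar R) < e%:E by rewrite lte_fin.
  apply: filterS (cvge_lt_near rhoF e0') => n.
  move=> /ereal_inf_lt[al [_ hal] /ltW ale] s t Cs Ct.
  by apply: le_trans (hal _ _ Cs Ct) _; exact: leeD2r.
- move=> r; have : -oo < r%:E by rewrite ltNyr.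
  rewrite -tightF => /ereal_inf_lt[_ [K cK <-] hK]; exists K => //.
  apply: filterS (limn_esup_lt_near hK) => n /ltW.
  rewrite ext_lscE //; apply: lsc_max_indic; apply: closed_openC.
  exact: (compact_closed_metrizable d_metric).
- move: massF => /ereal_lt_split[M /andP[hM _]]; exists M.
  apply: filterS (limn_esup_lt_near hM) => n /ltW.
  have -> : max_indic [set: Y] = (fun=> 0) :> (Y -> \bar R).
    by apply/funext => y; rewrite /max_indic mem_set.
  have C0 : Cb (fun _ : Y => 0 : \bar R) by apply: Cb_cst; rewrite ltry.
  by rewrite ext_lscE ?ext_lsc_Cb //; exact: Cb_lsc.
Qed.

Lemma not_near_frequently (P : nat -> Prop) : ~ (\forall n \near \oo, P n) ->
  forall N, exists2 n, (N <= n)%N & ~ P n.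
Proof.
move=> nP N; apply: contrapT => hN; apply: nP; exists N => // n /= Nn.
by apply: contrapT => nPn; apply: hN; exists n.
Qed.

Lemma discrete_continuous (phi : Y -> \bar R) : (forall A : set Y, open A) ->
  continuous phi.
Proof.
move=> oY y A /nbhs_singleton Ay.
have : nbhs y [set y] by apply: open_nbhs_nbhs; split.
by apply: filterS => z /= ->.
Qed.

End Assembly.

Theorem theorem5p2 (R : realType) (X Y : topologicalType)
    (hX : hausdorff_space X) (hY : @polish_space R Y)
    (b : X -> Y -> \bar R) (hb : standing_assumptions b)
    (Fs : nat -> (Y -> \bar R) -> \bar R)
    (hQL : forall n, QL (Fs n))
    (htight : asymptotically_tight Fs)
    (hmass : limn_esup (fun n => ext (Fs n) (max_indic [set: Y])) < +oo)
    (hrho : rho (Fs n) @[n --> \oo] --> (0 : \bar R))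
    (g : X -> \bar R)
    (hg : forall x, g x = limn_esup (fun n => ext (Fs n) (b x)))
    (hdiscr : (forall A : set Y, open A) \/
       ((forall x, continuous (b x)) /\ forall y, -oo < conjugate b g y))
    (hcoer : Fc b (conjugate b g) \/ coercive b)
    (hucoer : upper_coercive b)
    (hqc : quasi_continuous_on_dom (conjugate b g)) :
  let Bg := conjugate b g in
  let Fbar := form_of_density Bg in
  let Phi := inv_subdiff b g in
  (* (i) *)
  [/\ exists2 F, Lin F & weak_accumulation Fs F,
  (* (ii) *)
      is_covering (ldom Bg) Phi (idom g),
  (* (iii) *)
      (forall (F : (Y -> \bar R) -> \bar R) (f : Y -> \bar R),
         weak_accumulation Fs F -> lsc_density F f ->
         forall y, Bg y <= f y) /\
      (forall C : set Y, closed C ->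
         limn_esup (fun n => ext (Fs n) (max_indic C)) <=
           Fbar (max_indic C)) &
      (forall x, ext (Fs n) (b x) @[n --> \oo] --> g x) ->
      let Z := alg_essential (ldom Bg) Phi (idom g) `|`
               relative_interior (edom Bg)
                 (top_essential (ldom Bg) Phi (idom g)) in
  (* (iv) *)
      ((forall (F : (Y -> \bar R) -> \bar R) (f : Y -> \bar R),
          weak_accumulation Fs F -> lsc_density F f ->
          forall y, Z y -> f y = Bg y) /\
       (forall G : set Y, open G ->
          Fbar (max_indic (G `&` Z)) <=
            limn_einf (fun n => ext (Fs n) (max_indic G)))) /\
  (* (v) *)
      (top_minimal_covering (ldom Bg) Phi (idom g) -> weak_cvg Fs Fbar)].
Proof.
move=> Bg Fbar Phi.
have [[D cD dD] [d [d_metric d_top _]]] := hY.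
have [b_lt b_ls _ _] := hb.
have b_lsc x : lsc (b x) by split.
have amF := asymptotically_maxplus_of_tight d_metric d_top hQL htight hmass hrho.
have extb n x : ext (Fs n) (b x) = ext_lsc (Fs n) (b x) by exact: ext_lscE.
have gE x : g x = limn_esup (fun n => ext_lsc (Fs n) (b x)).
  by rewrite hg; congr limn_esup; apply/funext => n.
have b_cts x : continuous (b x).
  by case: hdiscr => [oY|[]//]; exact: discrete_continuous.
have compactness := weak_sequential_compactness d_metric d_top cD dD.
split.
- have [s hs [f [lf [m mf] cvgf]]] := compactness _ amF.
  by exists (form_of_density f); [exact: Lin_form_of_density mf|exists s].
- move=> x gx.
  have [y sub_y _] := exists_charged_subgradient d_metric d_top b_lsc amF gE
    (b_cts x) hucoer gx.
  exists y => //; rewrite /ldom /= /Bg (subdiff_conjugate sub_y).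
  case: sub_y => bxy _; case: gx => gx _.
  by rewrite -(fineK bxy) -(fineK gx) -EFinB ltry.
- split.
    move=> F f [s hs cvgF] Ff.
    exact: (conjugate_le_density d_metric d_top b_lsc hQL gE hs cvgF Ff).
  by move=> C; exact: (limn_esup_closed_le d_metric d_top b_lsc amF gE).
move=> glim Z.
have glim' x : ext_lsc (Fs n) (b x) @[n --> \oo] --> g x.
  by have := glim x; under eq_fun do rewrite extb.
have eqZ F f (s : nat -> nat) : {homo s : m n / (m < n)%N} ->
    weak_cvg (fun k => Fs (s k)) F -> lsc_density F f ->
    forall y, Z y -> f y = Bg y.
  move=> hs cvgF Ff.
  exact: (density_eq_on_essential d_metric d_top b_lsc amF gE glim' b_cts
    hucoer hqc hs cvgF Ff).
split; first split.
- by move=> F f [s hs cvgF]; exact: (eqZ F f s hs cvgF).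
- move=> G oG; rewrite leNgt; apply/negP => /ereal_lt_split[t /andP[liminf_t t_Fbar]].
  have [|s hs s_t] := @frequently_subseq
      (fun n => ext_lsc (Fs n) (max_indic G) < t%:E).
    move=> N; have [|n Nn /negP] := @not_near_frequently
      (fun n => t%:E <= ext_lsc (Fs n) (max_indic G)) _ N; last first.
      by rewrite -ltNge; exists n.
    move=> near_t; move: liminf_t; rewrite /limn_einf lteNl ltNge => /negP; apply.
    apply: near_limn_esup_le; apply: filterS near_t => n h.
    rewrite -[_ <= _]/(- ext (Fs n) (max_indic G) <= - t%:E) leeN2.
    by rewrite ext_lscE //; exact: lsc_max_indic.
  have [s' hs' [f [lf [m mf] cvgf]]] := compactness _ (asymptotically_maxplus_subseq hs amF).
  have hss' : {homo (s \o s') : m n / (m < n)%N} by move=> i j ij; exact/hs/hs'.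
  have [y] := form_of_density_gt t_Fbar.
  rewrite /max_indic; case: ifPn => [/set_mem[Gy Zy]|_]; last by rewrite addNye.
  rewrite -(eqZ _ _ _ hss' cvgf (conj lf (fun _ _ => erefl)) y Zy) add0e.
  move=> tf; have fy : f y \is a fin_num.
    by move: (mf y) tf; case: (f y).
  have : (t + fine (f y))%:E < max_indic G y.
    rewrite /max_indic mem_set // lte_fin.
    by move: tf; rewrite -(fineK fy) lte_fin /=; lra.
  move=> /(lsc_minorant_gt d_metric d_top (lsc_max_indic oG))[psi [Cpsi psi_le psi_y]].
  have : form_of_density f psi <= t%:E.
    apply: cvge_to_le (cvgf _ Cpsi) _; apply: nearW => k; apply: ltW.
    by apply: le_lt_trans (s_t (s' k)); exact: Cb_le_ext_lsc.
  apply/negP; rewrite -ltNge; apply: lt_le_trans (form_of_density_ge f psi y).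
  by rewrite lteBrDr // -(fineK fy) -EFinD.
move=> [_ top_ess] phi Cphi A FA; apply: contrapT => nA.
have [s hs sA] := frequently_subseq (not_near_frequently nA).
have [s' hs' [f [lf [m mf] cvgf]]] := compactness _ (asymptotically_maxplus_subseq hs amF).
have hss' : {homo (s \o s') : m n / (m < n)%N} by move=> i j ij; exact/hs/hs'.
have Ff : lsc_density (form_of_density f) f by split.
(* Where Bg = +oo, f >= Bg forces equality; on ldom Bg every point lies
   in Z. For discrete Y, singletons are open, so that topologically essential
   points are algebraically essential. *)
have fE : f = Bg.
  apply/funext => y; have [Bgy|] := eqVneq (Bg y) +oo.
    apply/eqP; rewrite Bgy -leye_eq -Bgy.
    exact: (conjugate_le_density d_metric d_top b_lsc hQL gE hss' cvgf Ff).
  rewrite -ltey => Bgy; apply: (eqZ _ _ _ hss' cvgf Ff).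
  case: hdiscr => [oY|[_ Bg_gt]].
    left; have [_ ess_y] := top_ess y Bgy; split => //.
    exact: (ess_y [set y] (oY _) erefl).
  right; have Dy : y \in edom Bg.
    by rewrite inE /edom /= fin_numE -ltNye -ltey Bg_gt Bgy.
  exists (SigSub Dy) => //; apply: filterS filterT => u _ /=.
  apply: top_ess; have /= := set_valP u.
  by rewrite /edom /ldom /= fin_numE ltey => /andP[].
have /(_ A) := cvgf _ Cphi; rewrite fE => /(_ FA)[N _ /(_ N (leqnn N))].
exact: sA.
Qed.
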